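(* Let $I$ be a nonempty set, let $D=[d_{ij}]_{i,j\in I}$ be a doubly stochastic operator on $\ell^2(I)$, and set $A=D^*D$. Then $$\|D\|_{\ell^2(I)\to\ell^2(I)}^2=\sup_{n\ge 1}\Theta(A^n)^{1/n},$$ where $n$ ranges over the positive integers. Moreover, for every integer $n\ge 1$, $$\Theta(A^n)^{1/n}\le \|D\|_{\ell^2(I)\to\ell^2(I)}^2\le \left(2\,\Theta(A^n)-\Theta(A^n)^2\right)^{1/(2n)}.$$
   Context: A doubly stochastic operator indexed by a set $I$ (finite, countably infinite or uncountable) is a matrix $D=[d_{ij}]_{i,j\in I}$ with real entries $d_{ij}\ge 0$ such that $\sum_{k\in I} d_{ik}=1$ and $\sum_{k\in I} d_{kj}=1$ for all $i,j\in I$. It acts by $(D\boldsymbol{x})_i=\sum_{j\in I} d_{ij}x_j$; it is known that this defines a bounded linear operator on $\ell^2(I)$ of norm at most $1$. $\|\cdot\|_{\ell^2(I)\to\ell^2(I)}$ denotes the operator norm. $D^*$ is the adjoint of $D$ on $\ell^2(I)$ (the transpose matrix), so $A=D^*D$ has entries $a_{ij}=\sum_{k\in I} d_{ki}d_{kj}$; $A$ and its powers $A^n$ are again doubly stochastic. For a doubly stochastic operator $B=[b_{ij}]_{i,j\in I}$, define $$\Theta(B):=\sup_{S}\frac{1}{|S|}\sum_{i,j\in S} b_{ij},$$ where $S$ runs over the nonempty finite subsets of $I$ and $|S|$ is the cardinality of $S$. *)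

(* Defs.v *)
From HB Require Import structures.
From mathcomp Require Import all_boot all_order all_algebra finmap.
From mathcomp Require Import all_classical all_reals all_analysis.

Set Implicit Arguments.
Unset Strict Implicit.
Unset Printing Implicit Defensive.

Import Order.TTheory GRing.Theory Num.Theory.

Local Open Scope classical_set_scope.
Local Open Scope ring_scope.

(* The index type only has to be a choiceType: [I] may be finite, countable or
   uncountable, and all sums over [I] are unordered sums. *)
Section DoublyStochastic.
Variables (R : realType) (I : choiceType).
Implicit Types (B C D : I -> I -> R) (x : I -> R) (f : I -> R).

(* Sum of an absolutely summable real family, as the sum of its positive part
   minus the sum of its negative part.  Not meaningful if [f] is not absolutely
   summable. *)
Definition usum f : R :=
  fine (\esum_(i in [set: I]) (Num.max (f i) 0)%:E)
  - fine (\esum_(i in [set: I]) (Num.max (- f i) 0)%:E).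

Definition doubly_stochastic D : Prop :=
  [/\ forall i j, 0 <= D i j,
      forall i, (\esum_(k in [set: I]) (D i k)%:E = 1)%E &
      forall j, (\esum_(k in [set: I]) (D k j)%:E = 1)%E].

Definition ell2 : set (I -> R) :=
  [set x | (\esum_(i in [set: I]) (x i ^+ 2)%:E < +oo)%E].

(* The Hilbert norm for [x] in [ell2]; it is 0 outside of [ell2]. *)
Definition l2norm x : R :=
  Num.sqrt (fine (\esum_(i in [set: I]) (x i ^+ 2)%:E)).

Definition opapp D x : I -> R := fun i => usum (fun j => D i j * x j).

(* The supremum is taken in R, so it is the operator norm only when [D] is
   bounded on [ell2]; a doubly stochastic [D] is a contraction of [ell2]. *)
Definition opnorm D : R :=
  sup [set l2norm (opapp D x) | x in [set x | ell2 x /\ l2norm x <= 1]].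

(* The adjoint of a real matrix. *)
Definition adjm D : I -> I -> R := fun i j => D j i.

Definition mulm B C : I -> I -> R := fun i j => usum (fun k => B i k * C k j).

Definition expm B (n : nat) : I -> I -> R :=
  iter n (mulm B) (fun i j => (i == j)%:R).

(* For doubly stochastic [B] the set is nonempty (if [I] is) and bounded by 1. *)
Definition Theta B : R :=
  sup [set (#|` S|%:R)^-1 * \sum_(i <- S) \sum_(j <- S) B i j
      | S in [set S : {fset I} | S != fset0%fset]].

End DoublyStochastic.

(* Main.v *)
(* The quadratic form of A on finitely supported nonnegative vectors x decides
   everything: |D x|^2 = <A x, x>, so |D|^2 is the least beta with
   <A x, x> <= beta |x|^2 for all such x. By Cauchy-Schwarz the moments
   m_n = <A^n x, x> are log-convex, hence m_1^n <= m_n m_0^(n-1). Their ratios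
   m_(n+1) / m_n increase and are at most |D|^2 for even n, as
   m_(2k+1) = |D A^k x|^2 and m_(2k) = |A^k x|^2, so m_n <= |D|^(2n) m_0; for
   x an indicator function this is Theta(A^n) <= |D|^(2n).
   For the upper bound, Cheeger's inequality for the doubly stochastic matrix
   A^n gives m_n^2 <= (2 Theta - Theta^2) m_0^2 with Theta = Theta(A^n); combine
   it with m_1^n <= m_n m_0^(n-1).
   For the equality, if x is supported on F then x_i x_j <= |x|^2, so that
   m_1^n <= m_n m_0^(n-1) <= |F| Theta(A^n) m_0^n; taking n-th roots removes the
   constant |F|. *)
Require Import Defs.
From mathcomp Require Import all_boot all_order all_algebra finmap.
From mathcomp Require Import all_classical all_reals all_analysis.
From mathcomp Require Import ring lra.
Import Order.TTheory GRing.Theory Num.Theory.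
Local Open Scope classical_set_scope.
Local Open Scope ring_scope.

Set Implicit Arguments.
Unset Strict Implicit.
Unset Printing Implicit Defensive.

(** * Finitely supported vectors and Cheeger's inequality *)

Definition qform (R : realFieldType) (I : eqType) (s : seq I) (x : I -> R)
    (B : I -> I -> R) : R :=
  \sum_(i <- s) \sum_(j <- s) B i j * (x i * x j).

Definition sqnorm (R : realFieldType) (I : eqType) (s : seq I)
    (x : I -> R) : R :=
  \sum_(i <- s) x i ^+ 2.

Section Finite.
Variables (R : realFieldType) (I : eqType).
Implicit Types (s t : seq I) (x f : I -> R) (B : I -> I -> R).

Lemma sqnorm_ge0 s x : 0 <= sqnorm s x.
Proof. by apply: sumr_ge0 => i _; exact: sqr_ge0. Qed.

Lemma exists_argmin s f :
  s != [::] -> exists2 k, k \in s & forall i, i \in s -> f k <= f i.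
Proof.
elim: s => // a s IH _; have [->|/IH[k ks kmin]] := eqVneq s [::].
  by exists a => [|i]; rewrite ?inE// => /eqP ->.
have [ak|ka] := leP (f a) (f k).
  exists a => [|i]; rewrite inE ?eqxx// => /predU1P[->//|/kmin].
  exact: le_trans.
exists k => [|i]; rewrite inE ?ks ?orbT// => /predU1P[->|/kmin//].
exact: ltW.
Qed.

(* Finite layer-cake argument: subtract from [f] its minimum on [s], which
   removes an index from the support of [f]. *)
Lemma sum_min_le s f B (theta : R) :
    (forall i, i \in s -> 0 <= f i) ->
    (forall t, subseq t s ->
       \sum_(i <- t) \sum_(j <- t) B i j <= theta * (size t)%:R) ->
  \sum_(i <- s) \sum_(j <- s) B i j * Num.min (f i) (f j)
    <= theta * \sum_(i <- s) f i.
Proof.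
have [n] := ubnP (size s); elim: n s f => // n IH s f; rewrite ltnS => sn f0 hB.
have [->|/(exists_argmin f)[k ks kmin]] := eqVneq s [::].
  by rewrite !big_nil mulr0.
pose g i := f i - f k; pose t := rem k s.
have st : perm_eq s (k :: t) by exact: perm_to_rem.
have ts : subseq t s by exact: rem_subseq.
have g0 i : i \in s -> 0 <= g i by move=> /kmin; rewrite subr_ge0.
have gk : g k = 0 by rewrite /g subrr.
have -> : \sum_(i <- s) \sum_(j <- s) B i j * Num.min (f i) (f j) =
    f k * (\sum_(i <- s) \sum_(j <- s) B i j)
      + \sum_(i <- t) \sum_(j <- t) B i j * Num.min (g i) (g j).
  have -> : \sum_(i <- t) \sum_(j <- t) B i j * Num.min (g i) (g j) =
      \sum_(i <- s) \sum_(j <- s) B i j * Num.min (g i) (g j).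
    symmetry; rewrite (perm_big _ st) big_cons/= big1_seq ?add0r.
      apply: eq_big_seq => i it; rewrite (perm_big _ st) big_cons/= gk min_r.
        by rewrite mulr0 add0r.
      by rewrite g0// (mem_subseq ts).
    by move=> j /andP[_ js]; rewrite gk min_l ?mulr0// g0.
  rewrite mulr_sumr -big_split/=; apply: eq_bigr => i _.
  rewrite mulr_sumr -big_split/=; apply: eq_bigr => j _.
  have -> : Num.min (f i) (f j) = f k + Num.min (g i) (g j).
    by rewrite addr_minr /g !(addrC (f k)) !subrK.
  by rewrite mulrDr (mulrC (B i j) (f k)).
have -> : \sum_(i <- s) f i = f k * (size s)%:R + \sum_(i <- t) g i.
  have <- : \sum_(i <- s) g i = \sum_(i <- t) g i.
    by rewrite (perm_big _ st) big_cons/= gk add0r.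
  rewrite -sum1_size natr_sum.
  rewrite mulr_sumr -big_split/=; apply: eq_bigr => i _.
  by rewrite mulr1 addrC subrK.
rewrite mulrDr lerD//.
  by rewrite mulrCA ler_wpM2l ?hB// f0.
apply: IH => [|i it|u ut].
- by rewrite (leq_trans _ sn)// [in X in (_ < X)%N](perm_size st).
- by rewrite g0// (mem_subseq ts).
- by rewrite hB// (subseq_trans ut ts).
Qed.

(** The minimum over [t] is attained at [b / c]. For [c = 0] the expression is affine in [t], and a
    nonzero slope would make it negative somewhere. *)
Lemma discriminant_le (a b c : R) :
  0 <= c -> (forall t : R, 0 <= a - 2 * t * b + t ^+ 2 * c) -> b ^+ 2 <= a * c.
Proof.
rewrite le_eqVlt => /predU1P[<- h|c0 /(_ (b / c))].
  have [->|b0] := eqVneq b 0; first by rewrite mulr0 expr0n.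
  (* This [t] makes the affine expression equal to [-1]. *)
  have := h ((a + 1) / (2 * b)).
  have -> : 2 * ((a + 1) / (2 * b)) * b = a + 1 by field.
  by rewrite mulr0 addr0; lra.
have -> : a - 2 * (b / c) * b + (b / c) ^+ 2 * c = (a * c - b ^+ 2) / c.
  by field; rewrite gt_eqF.
by rewrite pmulr_lge0 ?invr_gt0// subr_ge0.
Qed.

(* The discrete Cheeger inequality, with leakage [1 - \sum_(j <- s) B i j] at
   [i]. With [P := \sum B i j * min (x i ^+ 2) (x j ^+ 2)], the Cauchy-Schwarz
   inequality applied to [B i j * |x i - x j| * (x i + x j)] and to the leakage
   terms is [(N - P) ^+ 2 <= (N - M) * (N + M)], for [M := qform s x B] and
   [N := sqnorm s x]. *)
Lemma cheeger s x B (theta : R) :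
    (forall i j, 0 <= B i j) -> (forall i j, B i j = B j i) ->
    (forall i, \sum_(j <- s) B i j <= 1) ->
    (forall t, subseq t s ->
       \sum_(i <- t) \sum_(j <- t) B i j <= theta * (size t)%:R) ->
    (forall i, 0 <= x i) -> theta <= 1 ->
  qform s x B ^+ 2 <= (2 * theta - theta ^+ 2) * sqnorm s x ^+ 2.
Proof.
move=> B0 Bsym B1 hB x0 theta1.
have M0 : 0 <= qform s x B.
  by do 2![apply: sumr_ge0 => ? _]; rewrite !mulr_ge0.
have [P [PN hP]] : exists P, P <= theta * sqnorm s x /\ forall t : R,
    0 <= (sqnorm s x - qform s x B) - 2 * t * (sqnorm s x - P)
         + t ^+ 2 * (sqnorm s x + qform s x B).
  exists (\sum_(i <- s) \sum_(j <- s) B i j * Num.min (x i ^+ 2) (x j ^+ 2)).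
  split=> [|t]; first by apply: sum_min_le => // i _; exact: sqr_ge0.
  set P := \sum_(i <- s) _.
  pose Q := \sum_(i <- s) (\sum_(j <- s) B i j) * x i ^+ 2.
  have QN : Q <= sqnorm s x.
    by apply: ler_sum => i _; rewrite ler_piMl// sqr_ge0.
  have Q1 : Q = \sum_(i <- s) \sum_(j <- s) B i j * x i ^+ 2.
    by apply: eq_bigr => i _; rewrite mulr_suml.
  have Q2 : Q = \sum_(i <- s) \sum_(j <- s) B i j * x j ^+ 2.
    rewrite Q1 exchange_big; apply: eq_bigr => i _; apply: eq_bigr => j _.
    by rewrite Bsym.
  (* This is twice the quadratic in [t] with [sqnorm s x] lowered to [Q]; the leakage contributes
     [(1 - t) ^+ 2] times a nonnegative quantity. *)
  suff : 0 <= (1 - t) ^+ 2 * (Q + Q) + 4 * t * P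
              - 2 * (1 - t ^+ 2) * qform s x B.
    by move: (ler_wpM2l (sqr_ge0 (1 - t)) QN); nra.
  rewrite {1}Q1 Q2 /P /qform -big_split/= !mulr_sumr -big_split -sumrB/=.
  apply: sumr_ge0 => i _.
  rewrite -big_split/= !mulr_sumr -big_split -sumrB/=.
  apply: sumr_ge0 => j _.
  (* Each pair contributes a square, since [|x i ^+ 2 - x j ^+ 2|] is the sum of the two squares
     minus twice their minimum. *)
  have -> : (1 - t) ^+ 2 * (B i j * x i ^+ 2 + B i j * x j ^+ 2) +
      4 * t * (B i j * Num.min (x i ^+ 2) (x j ^+ 2)) -
      2 * (1 - t ^+ 2) * (B i j * (x i * x j)) =
      B i j * (`|x i - x j| - t * (x i + x j)) ^+ 2.
    have [le|/ltW le] := leP (x i) (x j).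
      by rewrite min_l ?ler_sqr ?nnegrE// distrC ger0_norm ?subr_ge0//; ring.
    by rewrite min_r ?ler_sqr ?nnegrE// ger0_norm ?subr_ge0//; ring.
  by rewrite mulr_ge0// sqr_ge0.
have N0 := sqnorm_ge0 s x.
have /discriminant_le : 0 <= sqnorm s x + qform s x B by rewrite addr_ge0.
move=> /(_ _ _ hP) CS.
(* With [CS] this gives [(1 - theta)^2 N^2 <= N^2 - M^2], and
   [1 - (1 - theta)^2 = 2 theta - theta^2]. *)
have : ((1 - theta) * sqnorm s x) ^+ 2 <= (sqnorm s x - P) ^+ 2.
  by rewrite ler_sqr ?nnegrE//; [lra|nra|nra].
by move: CS; rewrite !expr2; nra.
Qed.

End Finite.

(** * Log-convex sequences and exponential growth *)

Section LogConvex.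
Variables (R : realFieldType) (m : nat -> R).
Hypothesis m0 : forall k, 0 <= m k.
Hypothesis lc : forall k, m k.+1 ^+ 2 <= m k * m k.+2.

(** The ratios [m k.+1 / m k] are nondecreasing, so the first is the least; the cross-multiplied
    form allows zero terms. *)
Lemma logconvex_mul k : m 1 * m k <= m 0 * m k.+1.
Proof.
elim: k => [|k IH]; first by rewrite mulrC.
have := m0 k; rewrite le_eqVlt => /orP[/eqP mk|mk].
  have := lc k; rewrite -mk mul0r => mk1.
  have /eqP -> : m k.+1 == 0.
    by rewrite -sqrf_eq0 eq_le mk1 sqr_ge0.
  by rewrite mulr0 mulr_ge0.
rewrite -(ler_pM2r mk).
apply: (@le_trans _ _ (m 0 * m k.+1 ^+ 2)).
  by rewrite mulrAC expr2 mulrA ler_wpM2r.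
by rewrite -mulrA ler_wpM2l// mulrC [leRHS]mulrC mulrC lc.
Qed.

Lemma logconvex_exp n : m 1 ^+ n.+1 <= m n.+1 * m 0 ^+ n.
Proof.
elim: n => [|n IH]; first by rewrite expr1 expr0 mulr1.
rewrite exprS; apply: (le_trans (ler_wpM2l (m0 1) IH)).
rewrite mulrA exprS (mulrA (m n.+2)) ler_wpM2r ?exprn_ge0//.
by rewrite [leRHS]mulrC logconvex_mul.
Qed.

(** By monotonicity the ratio at an odd index is at most the one at the next even index, so [l]
    bounds every ratio. *)
Lemma logconvex_ratio (l : R) : 0 <= l -> (forall k, m k.*2.+1 <= l * m k.*2) ->
  forall n, m n <= l ^+ n * m 0.
Proof.
move=> l0 hl.
have step k : m k.+1 <= l * m k.
  rewrite -[k]odd_double_half; case: (odd k); last exact: hl.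
  rewrite add1n; set j := k./2.
  have := m0 j.*2.+2; rewrite le_eqVlt => /orP[/eqP <-|p].
    by rewrite mulr_ge0.
  rewrite -(ler_pM2r p) -expr2 (le_trans (lc _))// -mulrA (mulrC l).
  rewrite -mulrA ler_wpM2l// mulrC.
  by have := hl j.+1; rewrite doubleS.
elim=> [|n IH]; first by rewrite mul1r.
by rewrite (le_trans (step n))// exprS -mulrA ler_wpM2l.
Qed.

End LogConvex.

Lemma bernoulli_le (R : realDomainType) (h : R) n :
  0 <= h -> 1 + n%:R * h <= (1 + h) ^+ n.
Proof.
move=> h0; elim: n => [|n IH]; first by rewrite mul0r addr0.
rewrite exprS -natr1; have := ler0n R n.
have := ler_wpM2l (addr_ge0 ler01 h0) IH; nra.
Qed.

(** If [b < a], Bernoulli's inequality makes the powers of [a / b] outgrow any constant [C]. *)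
Lemma exp_dominated (R : archiRealFieldType) (a b C : R) : 0 <= a -> 0 <= b ->
  (forall n, a ^+ n.+1 <= C * b ^+ n.+1) -> a <= b.
Proof.
move=> a0; rewrite le_eqVlt => /predU1P[<- /(_ 0%N)|b0 hC].
  by rewrite !expr1 mulr0.
rewrite leNgt; apply/negP => ba.
pose h := a / b - 1.
have h0 : 0 < h by rewrite subr_gt0 ltr_pdivlMr// mul1r.
have hn n : n.+1%:R * h < C.
  have : (a / b) ^+ n.+1 <= C by rewrite expr_div_n ler_pdivrMr ?exprn_gt0.
  have -> : a / b = 1 + h by rewrite /h addrC subrK.
  by have := bernoulli_le n.+1 (ltW h0); lra.
have C0 : 0 <= C / h.
  by rewrite divr_ge0 ?(ltW h0)// ltW// (le_lt_trans _ (hn 0%N))// mul1r ltW.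
have := archi_boundP C0; rewrite ltr_pdivrMr// => /lt_trans/(_ (hn _)).
by rewrite ltxx.
Qed.

(** * Unordered sums and doubly stochastic matrices *)

Section Esum.
Variables (R : realType) (I : choiceType).
Implicit Types (f g : I -> R) (F : {fset I}).
Local Notation tot f := (\esum_(i in [set: I]) (f i)%:E).

Lemma esum_exchange (a : I -> I -> R) : (forall i j, 0 <= a i j) ->
  (\esum_(i in [set: I]) \esum_(j in [set: I]) (a i j)%:E =
   \esum_(j in [set: I]) \esum_(i in [set: I]) (a i j)%:E)%E.
Proof.
move=> a0; rewrite !esum_esum; try by move=> *; rewrite lee_fin.
apply: (reindex_esum _ _ (fun x : I * I => (x.2, x.1))); split=> //=.
- by move=> [i1 i2] [j1 j2] /= _ _ [-> ->].
- by move=> [i j] _; exists (j, i).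
Qed.

Lemma fset_le_esum f F : (forall i, 0 <= f i) ->
  ((\sum_(i <- F) f i)%:E <= tot f)%E.
Proof.
move=> f0; rewrite -sumEFin; apply: esum_ge; exists [set` F] => //.
by rewrite fsbig_finite// set_fsetK.
Qed.

Lemma esum_le_fset f (c : R) :
  (forall F, \sum_(i <- F) f i <= c) -> (tot f <= c%:E)%E.
Proof.
move=> hF; apply: ge_ereal_sup => _ [A [finA _] <-].
by rewrite fsbig_finite// sumEFin lee_fin.
Qed.

Lemma term_le_esum f i : (forall i, 0 <= f i) -> ((f i)%:E <= tot f)%E.
Proof.
by move=> /(@fset_le_esum f [fset i]%fset); rewrite big_seq_fset1.
Qed.

Lemma esumZl (c : R) f : 0 <= c -> (forall i, 0 <= f i) ->
  tot (fun i => c * f i) = (c%:E * tot f)%E.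
Proof.
have le_esumZl (d : R) g : 0 <= d -> (forall i, 0 <= g i) ->
    (tot (fun i => (d * g i)%R) <= d%:E * tot g)%E.
  move=> d0 g0; apply: ge_ereal_sup => _ [A [finA _] <-].
  rewrite fsbig_finite// sumEFin -mulr_sumr EFinM lee_wpmul2l ?lee_fin//.
  exact: fset_le_esum.
rewrite le_eqVlt => /predU1P[<- f0|c0 f0].
  by rewrite mul0e esum1// => i _; rewrite mul0r.
apply/eqP; rewrite eq_le le_esumZl ?(ltW c0)//=.
have cf0 i : 0 <= c * f i by rewrite mulr_ge0// ltW.
(* The reverse inequality is the same one, applied to [c^-1] and the family [c * f i]. *)
have := le_esumZl c^-1 _ _ cf0; rewrite invr_ge0 (ltW c0) => /(_ isT).
under eq_esum do rewrite mulKf ?gt_eqF//.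
have cE : (0 <= c%:E)%E by rewrite lee_fin ltW.
by move=> /(lee_wpmul2l cE); rewrite muleA -EFinM mulfV ?gt_eqF// mul1e.
Qed.

Lemma usumE f : (forall i, 0 <= f i) -> usum f = fine (tot f).
Proof.
move=> f0; rewrite /usum [X in _ - fine X]esum1 ?subr0; last first.
  by move=> i _; rewrite max_r// oppr_le0.
by congr fine; apply: eq_esum => i _; rewrite max_l.
Qed.

(** The finite bound matters because [fine] sends an infinite sum to 0. *)
Lemma usum_esum f (c : R) : (forall i, 0 <= f i) -> (tot f <= c%:E)%E ->
  (usum f)%:E = tot f.
Proof.
move=> f0 fc; rewrite usumE// fineK// ge0_fin_numE.
  by rewrite (le_lt_trans fc)// ltry.
by apply: esum_ge0 => i _; rewrite lee_fin.
Qed.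

Lemma usum_ge0 f : (forall i, 0 <= f i) -> 0 <= usum f.
Proof.
by move=> f0; rewrite usumE// fine_ge0// esum_ge0// => i _; rewrite lee_fin.
Qed.

Lemma usum_eq f (c : R) : (forall i, 0 <= f i) -> tot f = c%:E -> usum f = c.
Proof. by move=> f0 fc; rewrite usumE// fc. Qed.

(** Discriminant of the sum of [(f i - t * g i) ^+ 2]. For [t < 0] every term has the right sign;
    for [t >= 0] the cross term is moved to the other side, so that only nonnegative families are
    summed. *)
Lemma esum_cauchy_schwarz f g (p a b : R) :
    (forall i, 0 <= f i) -> (forall i, 0 <= g i) ->
    tot (fun i => f i * g i) = p%:E ->
    tot (fun i => f i * f i) = a%:E ->
    tot (fun i => g i * g i) = b%:E ->
  p ^+ 2 <= a * b.
Proof.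
move=> f0 g0 hp ha hb.
have ge0 h (c : R) : (forall i, 0 <= h i) -> tot h = c%:E -> 0 <= c.
  by move=> h0 hc; rewrite -lee_fin -hc esum_ge0// => i _; rewrite lee_fin.
have p0 : 0 <= p by apply: ge0 hp => i; rewrite mulr_ge0.
have a0 : 0 <= a by apply: ge0 ha => i; rewrite mulr_ge0.
have b0 : 0 <= b by apply: ge0 hb => i; rewrite mulr_ge0.
apply: discriminant_le => // t; have [t0|t0] := ltP t 0.
  have := mulr_ge0 (sqr_ge0 t) b0; have := mulr_le0_ge0 (ltW t0) p0; lra.
suff : 2 * t * p <= a + t ^+ 2 * b by lra.
rewrite -lee_fin EFinM -hp -esumZl ?mulr_ge0//; last first.
  by move=> i; rewrite mulr_ge0.
rewrite EFinD (EFinM _ b) -ha -hb -esumZl ?sqr_ge0//; last first.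
  by move=> i; rewrite mulr_ge0.
rewrite -esumD; last 2 first.
- by move=> i _; rewrite lee_fin mulr_ge0.
- by move=> i _; rewrite lee_fin mulr_ge0 ?sqr_ge0 ?mulr_ge0.
apply: le_esum => i _; rewrite -EFinD lee_fin.
by have := sqr_ge0 (f i - t * g i); rewrite !expr2; lra.
Qed.

End Esum.

Section DoublyStochastic.
Variables (R : realType) (I : choiceType).
Implicit Types (B C D E : I -> I -> R).
Local Notation idm := (fun i j : I => (i == j)%:R : R).

Lemma ds_ge0 B : doubly_stochastic B -> forall i j, 0 <= B i j.
Proof. by case. Qed.

Lemma ds_row B : doubly_stochastic B ->
  forall i, (\esum_(k in [set: I]) (B i k)%:E = 1)%E.
Proof. by case. Qed.

Lemma ds_le1 B : doubly_stochastic B -> forall i j, B i j <= 1.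
Proof.
case=> B0 Br _ i j; have := @term_le_esum _ _ (B i) j (B0 i).
by rewrite Br lee_fin.
Qed.

Lemma adjm_ds B : doubly_stochastic B -> doubly_stochastic (adjm B).
Proof.
by case=> B0 Br Bc; split=> [i j||]; [exact: B0|exact: Bc|exact: Br].
Qed.

(** Entries of [C] are at most 1, so row [i] of [B] dominates the sum. Identities between products
    can then be proved in the extended reals, where nonnegative sums may be exchanged. *)
Lemma mulm_esum B C i j : doubly_stochastic B -> doubly_stochastic C ->
  (mulm B C i j)%:E = (\esum_(k in [set: I]) (B i k * C k j)%:E)%E.
Proof.
move=> dB dC; apply: (@usum_esum _ _ _ 1) => [k|].
  by rewrite mulr_ge0// ds_ge0.
rewrite -(ds_row dB i); apply: le_esum => k _.
by rewrite lee_fin ler_piMr// (ds_ge0, ds_le1).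
Qed.

Lemma mulm_ge0 B C i j : doubly_stochastic B -> doubly_stochastic C ->
  0 <= mulm B C i j.
Proof. by move=> dB dC; apply: usum_ge0 => k; rewrite mulr_ge0// ds_ge0. Qed.

Lemma adjm_mulm B C : adjm (mulm B C) = mulm (adjm C) (adjm B).
Proof.
apply/funext => i; apply/funext => j; rewrite /adjm /mulm.
by congr usum; apply/funext => k; rewrite mulrC.
Qed.

Lemma mulm_row B C : doubly_stochastic B -> doubly_stochastic C ->
  forall i, (\esum_(k in [set: I]) (mulm B C i k)%:E = 1)%E.
Proof.
move=> dB dC i; have B0 := ds_ge0 dB; have C0 := ds_ge0 dC.
under eq_esum do rewrite mulm_esum//.
rewrite esum_exchange => [|k l]; last by rewrite mulr_ge0.
rewrite -(ds_row dB i); apply: eq_esum => l _.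
by rewrite esumZl// ds_row// mule1.
Qed.

Lemma mulm_ds B C : doubly_stochastic B -> doubly_stochastic C ->
  doubly_stochastic (mulm B C).
Proof.
move=> dB dC; split=> [i j||j]; [exact: mulm_ge0|exact: mulm_row|].
(* Column sums of a product are row sums of its adjoint. *)
have := mulm_row (adjm_ds dC) (adjm_ds dB) j.
by rewrite -adjm_mulm.
Qed.

Lemma mulmA B C E :
    doubly_stochastic B -> doubly_stochastic C -> doubly_stochastic E ->
  mulm B (mulm C E) = mulm (mulm B C) E.
Proof.
move=> dB dC dE; apply/funext => i; apply/funext => j; apply: EFin_inj.
have [[B0 C0] E0] := (ds_ge0 dB, ds_ge0 dC, ds_ge0 dE).
rewrite !mulm_esum//; try exact: mulm_ds.
transitivity (\esum_(k in [set: I]) \esum_(l in [set: I])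
    (B i k * C k l * E l j)%:E)%E.
  apply: eq_esum => k _; rewrite EFinM mulm_esum// -esumZl//.
    by apply: eq_esum => l _; rewrite mulrA.
  by move=> l; rewrite mulr_ge0.
rewrite esum_exchange => [|k l]; last by rewrite !mulr_ge0.
apply: eq_esum => l _; rewrite EFinM mulm_esum// muleC -esumZl//.
  by apply: eq_esum => k _; rewrite mulrC.
by move=> k; rewrite mulr_ge0.
Qed.

Lemma esum_delta (f : I -> R) i : (forall k, 0 <= f k) ->
  (\esum_(k in [set: I]) ((i == k)%:R * f k)%:E = (f i)%:E)%E.
Proof.
move=> f0; rewrite -(esum_set1 (t := i) (a := fun k => (f k)%:E)) ?lee_fin//.
rewrite [RHS]esum_mkcond; apply: eq_esum => k _.
by rewrite in_set1 eq_sym; case: eqP => _; rewrite ?mul1r ?mul0r.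
Qed.

Lemma idm_ds : doubly_stochastic idm.
Proof.
split=> [i j|i|j]; first exact: ler0n.
  rewrite -[RHS]/((fun=> 1 : R) i)%:E -esum_delta//.
  by apply: eq_esum => k _; rewrite mulr1.
rewrite -[RHS]/((fun=> 1 : R) j)%:E -esum_delta//.
by apply: eq_esum => k _; rewrite mulr1 eq_sym.
Qed.

Lemma mul1m B : doubly_stochastic B -> mulm idm B = B.
Proof.
move=> dB; apply/funext => i; apply/funext => j; apply: EFin_inj.
rewrite mulm_esum//; last exact: idm_ds.
by rewrite (esum_delta (f := fun k => B k j))// => k; exact: ds_ge0.
Qed.

Lemma adjm_idm : adjm idm = idm.
Proof. by apply/funext => i; apply/funext => j; rewrite /adjm eq_sym. Qed.

Lemma expm_ds B n : doubly_stochastic B -> doubly_stochastic (expm B n).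
Proof.
by move=> dB; elim: n => [|n IH]; [exact: idm_ds|exact: mulm_ds].
Qed.

Lemma expmD B m n : doubly_stochastic B ->
  expm B (m + n) = mulm (expm B m) (expm B n).
Proof.
move=> dB; elim: m => [|m IH]; first by rewrite mul1m//; exact: expm_ds.
by rewrite addSn /= IH mulmA//; exact: expm_ds.
Qed.

Lemma expm1 B : doubly_stochastic B -> expm B 1 = B.
Proof.
(* [expm B 1] is [mulm B] of the identity; the right unit law is the adjoint of the left one. *)
move=> dB; rewrite -[RHS]/(adjm (adjm B)) -(mul1m (adjm_ds dB)).
by rewrite adjm_mulm adjm_idm.
Qed.

Lemma expmSr B n : doubly_stochastic B ->
  expm B n.+1 = mulm (expm B n) B.
Proof. by move=> dB; rewrite -addn1 expmD// expm1. Qed.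

Lemma adjm_expm B n : doubly_stochastic B -> adjm B = B ->
  adjm (expm B n) = expm B n.
Proof.
move=> dB Bs; elim: n => [|n IH]; first exact: adjm_idm.
by rewrite {1}/expm iterS -/(expm B n) adjm_mulm IH Bs expmSr.
Qed.

Lemma gram_ds D : doubly_stochastic D -> doubly_stochastic (mulm (adjm D) D).
Proof. by move=> dD; apply: mulm_ds => //; exact: adjm_ds. Qed.

Lemma adjm_gram D : adjm (mulm (adjm D) D) = mulm (adjm D) D.
Proof. by rewrite adjm_mulm. Qed.

Lemma gram_mulm B C : doubly_stochastic B -> doubly_stochastic C ->
  mulm (adjm (mulm B C)) (mulm B C) =
  mulm (mulm (adjm C) (mulm (adjm B) B)) C.
Proof.
move=> dB dC; have [dB' dC'] := (adjm_ds dB, adjm_ds dC).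
by rewrite adjm_mulm !mulmA//; exact: mulm_ds.
Qed.

End DoublyStochastic.

(** * The operator norm and the quadratic form of the Gram matrix *)

(** For duplicate-free [s], the image under [B] of the truncation of [x] to [s]; being a finite sum,
    it raises no summability question. *)
Definition fapp (R : realType) (I : choiceType) (B : I -> I -> R) (s : seq I)
    (x : I -> R) : I -> R :=
  fun i => \sum_(j <- s) B i j * x j.

Section Gram.
Variables (R : realType) (I : choiceType).
Implicit Types (B C D : I -> I -> R) (s : seq I) (x y : I -> R).

Lemma fapp_ge0 B s x : doubly_stochastic B -> (forall i, 0 <= x i) ->
  forall i, 0 <= fapp B s x i.
Proof.
by move=> dB x0 i; apply: sumr_ge0 => j _; rewrite mulr_ge0// ds_ge0.
Qed.

(** The adjoint relation [<B x, C x> = <B^* C x, x>] for truncated [x]: nonnegativity lets the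
    finite sums leave the infinite one. *)
Lemma esum_gram B C s x : doubly_stochastic B -> doubly_stochastic C ->
    (forall i, 0 <= x i) ->
  (\esum_(i in [set: I]) (fapp B s x i * fapp C s x i)%:E =
   (qform s x (mulm (adjm B) C))%:E)%E.
Proof.
move=> dB dC x0; have [B0 C0] := (ds_ge0 dB, ds_ge0 dC).
transitivity (\esum_(i in [set: I]) \sum_(j <- s) \sum_(l <- s)
    (x j * x l * (B i j * C i l))%:E)%E.
  apply: eq_esum => i _; rewrite /fapp mulr_suml -sumEFin.
  apply: eq_bigr => j _; rewrite mulr_sumr -sumEFin.
  by apply: eq_bigr => l _; congr EFin; ring.
have nn i j l : (0 <= (x j * x l * (B i j * C i l))%:E)%E.
  by rewrite lee_fin !mulr_ge0.
rewrite esum_sum => [|i j _ _]; last exact: sume_ge0.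
rewrite /qform -sumEFin; apply: eq_bigr => j _.
rewrite esum_sum => [|//]; rewrite -sumEFin; apply: eq_bigr => l _.
rewrite esumZl ?mulr_ge0// => [|i]; last by rewrite mulr_ge0.
by rewrite [in RHS]mulrC [RHS]EFinM mulm_esum//; exact: adjm_ds.
Qed.

Lemma opapp_fapp D B s x : doubly_stochastic D -> doubly_stochastic B ->
  (forall i, 0 <= x i) -> opapp D (fapp B s x) = fapp (mulm D B) s x.
Proof.
move=> dD dB x0; have [D0 B0] := (ds_ge0 dD, ds_ge0 dB).
apply/funext => i; apply: usum_eq => [j|].
  by rewrite mulr_ge0// fapp_ge0.
transitivity (\esum_(j in [set: I]) \sum_(l <- s)
    (x l * (D i j * B j l))%:E)%E.
  apply: eq_esum => j _; rewrite /fapp mulr_sumr -sumEFin.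
  by apply: eq_bigr => l _; congr EFin; ring.
rewrite esum_sum => [|j l _ _]; last by rewrite lee_fin !mulr_ge0.
rewrite /fapp -sumEFin; apply: eq_bigr => l _.
rewrite esumZl// => [|j]; last by rewrite mulr_ge0.
by rewrite [in RHS]mulrC [RHS]EFinM mulm_esum.
Qed.

Lemma qform_gram_cauchy_schwarz B C s x :
    doubly_stochastic B -> doubly_stochastic C -> (forall i, 0 <= x i) ->
  qform s x (mulm (adjm B) C) ^+ 2 <=
  qform s x (mulm (adjm B) B) * qform s x (mulm (adjm C) C).
Proof.
move=> dB dC x0; apply: (@esum_cauchy_schwarz _ _ (fapp B s x) (fapp C s x)).
- exact: fapp_ge0.
- exact: fapp_ge0.
- exact: esum_gram.
- exact: esum_gram.
- exact: esum_gram.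
Qed.

Lemma qform_ge0 B s x : doubly_stochastic B -> (forall i, 0 <= x i) ->
  0 <= qform s x B.
Proof.
by move=> dB x0; do 2![apply: sumr_ge0 => ? _]; rewrite !mulr_ge0// ds_ge0.
Qed.

Lemma l2norm_sqr x (a : R) : (\esum_(i in [set: I]) (x i * x i)%:E = a%:E)%E ->
  ell2 x /\ l2norm x ^+ 2 = a.
Proof.
move=> xa; rewrite /ell2 /l2norm /=.
have -> : (\esum_(i in [set: I]) (x i ^+ 2)%:E = a%:E)%E.
  by rewrite -xa; apply: eq_esum => i _; rewrite expr2.
split; [exact: ltry|rewrite sqr_sqrtr//=].
by rewrite -lee_fin -xa esum_ge0// => i _; rewrite lee_fin -expr2 sqr_ge0.
Qed.

Lemma ds_row_le1 B (F : {fset I}) i : doubly_stochastic B ->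
  \sum_(j <- F) B i j <= 1.
Proof.
move=> dB; rewrite -lee_fin -(ds_row dB i).
by apply: (@fset_le_esum _ _ (B i)) => j; exact: ds_ge0.
Qed.

(* Schur's test, as [2 * x i * x j <= x i ^+ 2 + x j ^+ 2]. *)
Lemma qform_le_sqnorm B (F : {fset I}) x : doubly_stochastic B ->
  qform F x B <= sqnorm F x.
Proof.
move=> dB; have B0 := ds_ge0 dB.
apply: (@le_trans _ _ (2^-1 * (\sum_(i <- F) \sum_(j <- F) B i j * x i ^+ 2)
    + 2^-1 * (\sum_(i <- F) \sum_(j <- F) B i j * x j ^+ 2))).
  rewrite -mulrDr -big_split mulr_sumr; apply: ler_sum => i _.
  rewrite -big_split mulr_sumr; apply: ler_sum => j _ /=.
  rewrite -mulrDr [leRHS]mulrCA ler_wpM2l//.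
  by have := sqr_ge0 (x i - x j); rewrite !expr2; lra.
have h C : doubly_stochastic C ->
    \sum_(i <- F) \sum_(j <- F) C i j * x i ^+ 2 <= sqnorm F x.
  move=> dC; apply: ler_sum => i _; rewrite -mulr_suml.
  by rewrite ler_piMl ?sqr_ge0// ds_row_le1.
rewrite [X in _ + 2^-1 * X]exchange_big/=.
by have := h _ dB; have := h _ (adjm_ds dB); rewrite /adjm; lra.
Qed.

(** Positivity of [D] gives [|D x| <= D |x|] entrywise, so only [y = |x|] matters. The bound holds
    for truncations of [y], and it passes to [v = D y] by testing [v] on a finite set against those
    truncations. *)
Lemma l2norm_opapp_le D (beta : R) : doubly_stochastic D -> 0 <= beta ->
    (forall (F : {fset I}) x, (forall i, 0 <= x i) ->
       qform F x (mulm (adjm D) D) <= beta * sqnorm F x) ->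
  forall x, ell2 x -> l2norm x <= 1 -> l2norm (opapp D x) ^+ 2 <= beta.
Proof.
move=> dD beta0 hbeta x x2 x1; have D0 := ds_ge0 dD.
have [y y0 yE] : exists2 y : I -> R,
    (forall i, 0 <= y i) & forall i, y i = `|x i|.
  by exists (fun i => `|x i|).
have sq_fin : (\esum_(i in [set: I]) (x i ^+ 2)%:E \is a fin_num)%E.
  by rewrite ge0_fin_numE// esum_ge0// => i _; rewrite lee_fin sqr_ge0.
have sq0 : 0 <= fine (\esum_(i in [set: I]) (x i ^+ 2)%:E).
  by rewrite fine_ge0// esum_ge0// => i _; rewrite lee_fin sqr_ge0.
have y1 (F : {fset I}) : sqnorm F y <= 1.
  apply: (@le_trans _ _ (fine (\esum_(i in [set: I]) (x i ^+ 2)%:E))).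
    rewrite -lee_fin fineK//.
    have -> : sqnorm F y = \sum_(i <- F) x i ^+ 2.
      by apply: eq_bigr => i _; rewrite yE -normrX ger0_norm ?sqr_ge0.
    by apply: fset_le_esum => i; exact: sqr_ge0.
  by move: x1; rewrite /l2norm -{1}sqrtr1 ler_sqrt.
have step1 (F G : {fset I}) : \sum_(i <- F) fapp D G y i ^+ 2 <= beta.
  apply: (@le_trans _ _ (beta * sqnorm G y)); last by rewrite ler_piMr.
  apply: le_trans (hbeta G y y0).
  rewrite -lee_fin -esum_gram//; under eq_esum do rewrite -expr2.
  by apply: fset_le_esum => i; rewrite sqr_ge0.
have Dy0 i j : 0 <= D i j * y j by rewrite mulr_ge0.
(* The case of a singleton in [step1] makes every coordinate of [D y] finite. *)
have wfin i : (\esum_(j in [set: I]) (D i j * y j)%:E <= (Num.sqrt beta)%:E)%E.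
  apply: esum_le_fset => G; have := step1 [fset i]%fset G.
  rewrite big_seq_fset1 => h; rewrite -[leLHS]ger0_norm ?sumr_ge0//.
  by rewrite -sqrtr_sqr ler_sqrt.
pose v i := usum (fun j => D i j * y j).
have vE i : (v i)%:E = (\esum_(j in [set: I]) (D i j * y j)%:E)%E.
  exact: usum_esum (wfin i).
have v0 i : 0 <= v i by exact: usum_ge0.
have step3 (F : {fset I}) : \sum_(i <- F) v i ^+ 2 <= beta.
  set W := \sum_(i <- F) v i ^+ 2.
  (* With [u := fapp D G y], use [v i * u i <= (v i ^+ 2 + u i ^+ 2) / 2]. *)
  suff : W <= (W + beta) / 2 by lra.
  rewrite -lee_fin.
  have -> : (W%:E = \esum_(j in [set: I])
      (\sum_(i <- F) v i * (D i j * y j))%:E)%E.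
    transitivity (\esum_(j in [set: I]) \sum_(i <- F)
        (v i * (D i j * y j))%:E)%E; last first.
      by apply: eq_esum => j _; rewrite sumEFin.
    rewrite esum_sum => [|j i _ _]; last by rewrite lee_fin mulr_ge0.
    rewrite -sumEFin; apply: eq_bigr => i _.
    by rewrite esumZl// -vE -EFinM expr2.
  apply: esum_le_fset => G; rewrite exchange_big/=.
  have -> : \sum_(i <- F) \sum_(j <- G) v i * (D i j * y j) =
      \sum_(i <- F) v i * fapp D G y i.
    by apply: eq_bigr => i _; rewrite mulr_sumr.
  apply: (@le_trans _ _
      ((W + \sum_(i <- F) fapp D G y i ^+ 2) / 2)); last first.
    by have := step1 F G; lra.
  rewrite -big_split mulr_suml; apply: ler_sum => i _ /=.
  by have := sqr_ge0 (v i - fapp D G y i); rewrite !expr2; lra.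
have Dxv i : `|opapp D x i| <= v i.
  (* The positive and negative parts of row [i] both sum to a value in [[0, v i]], hence so does the
     absolute value of their difference. *)
  have part (g : I -> R) : (forall j, 0 <= g j <= D i j * y j) ->
      0 <= fine (\esum_(j in [set: I]) (g j)%:E) <= v i.
    move=> hg; have g0 j : 0 <= g j by case/andP: (hg j).
    have gv : (\esum_(j in [set: I]) (g j)%:E <= (v i)%:E)%E.
      by rewrite vE; apply: le_esum => j _; rewrite lee_fin; case/andP: (hg j).
    by rewrite -usumE// usum_ge0//= -lee_fin (usum_esum g0 gv).
  rewrite /opapp /usum ler_norml.
  have hp j : 0 <= Num.max (D i j * x j) 0 <= D i j * y j.
    by rewrite le_max lexx orbT/= ge_max Dy0 andbT yE ler_wpM2l// ler_norm.
  have hn j : 0 <= Num.max (- (D i j * x j)) 0 <= D i j * y j.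
    rewrite le_max lexx orbT/= ge_max Dy0 andbT yE -mulrN ler_wpM2l//.
    by rewrite -normrN ler_norm.
  by have := part _ hp; have := part _ hn; lra.
rewrite /l2norm sqr_sqrtr; last first.
  by rewrite fine_ge0// esum_ge0// => i _; rewrite lee_fin sqr_ge0.
rewrite -usumE => [|i]; last exact: sqr_ge0.
have le : (\esum_(i in [set: I]) (opapp D x i ^+ 2)%:E <= beta%:E)%E.
  apply: esum_le_fset => F; apply: le_trans (step3 F).
  apply: ler_sum => i _; rewrite -[leLHS]ger0_norm ?sqr_ge0// normrX.
  by rewrite ler_sqr ?nnegrE.
by rewrite -lee_fin (usum_esum _ le)// => i; exact: sqr_ge0.
Qed.

(** Schur's test is the case [beta = 1] of the previous bound; it makes the real supremum in
    [opnorm] meaningful. *)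
Lemma opnorm_has_sup D : doubly_stochastic D ->
  has_sup [set l2norm (opapp D x) | x in [set x | ell2 x /\ l2norm x <= 1]].
Proof.
move=> dD; split.
  pose z : I -> R := fun=> 0.
  have [z2 zn] : ell2 z /\ l2norm z ^+ 2 = 0.
    by apply: l2norm_sqr; rewrite esum1// => i _; rewrite mulr0.
  exists (l2norm (opapp D z)), z => //.
  by split=> //; move/eqP: zn; rewrite sqrf_eq0 => /eqP ->.
exists 1 => _ [x [x2 x1] <-].
rewrite -(@ler_pXn2r _ 2)// ?nnegrE ?sqrtr_ge0// expr1n.
apply: l2norm_opapp_le => // F y y0.
by rewrite mul1r qform_le_sqnorm//; exact: gram_ds.
Qed.

Lemma opnorm_ge0 D : doubly_stochastic D -> 0 <= opnorm D.
Proof.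
move=> dD; have [[r Er] ub] := opnorm_has_sup dD.
apply: le_trans (ub_le_sup ub Er); case: Er => x _ <-; exact: sqrtr_ge0.
Qed.

Lemma opnorm_sqr_le D (beta : R) : doubly_stochastic D -> 0 <= beta ->
    (forall (F : {fset I}) x, (forall i, 0 <= x i) ->
       qform F x (mulm (adjm D) D) <= beta * sqnorm F x) ->
  opnorm D ^+ 2 <= beta.
Proof.
move=> dD beta0 hbeta; have [E0 _] := opnorm_has_sup dD.
rewrite -[leRHS]sqr_sqrtr// ler_sqr ?nnegrE ?sqrtr_ge0 ?opnorm_ge0//.
apply: ge_sup => // _ [x [x2 x1] <-].
rewrite -[leLHS]ger0_norm ?sqrtr_ge0// -sqrtr_sqr ler_sqrt//.
exact: l2norm_opapp_le.
Qed.

Lemma qform_scale s x B (c : R) :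
  qform s (fun i => c * x i) B = c ^+ 2 * qform s x B.
Proof.
rewrite /qform mulr_sumr; apply: eq_bigr => i _.
by rewrite mulr_sumr; apply: eq_bigr => j _; ring.
Qed.

(** This is [|D y|^2 <= |D|^2 |y|^2] for [y = B x], a vector of [ell2] that may have infinite
    support. *)
Lemma qform_le_opnorm D B s x :
    doubly_stochastic D -> doubly_stochastic B -> (forall i, 0 <= x i) ->
  qform s x (mulm (adjm (mulm D B)) (mulm D B)) <=
  opnorm D ^+ 2 * qform s x (mulm (adjm B) B).
Proof.
move=> dD dB x0; set m := qform s x (mulm (adjm B) B).
have dDB := mulm_ds dD dB.
have m0 : 0 <= m by apply: qform_ge0 => //; exact: gram_ds.
apply/ler_addgt0Pr => e e0.
(* [t] exceeds [m] so that one can normalize by it even if [m = 0]. *)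
pose t := m + e / (opnorm D ^+ 2 + 1).
have L0 : 0 < opnorm D ^+ 2 + 1 by rewrite ltr_wpDl// sqr_ge0.
have t0 : 0 < t by rewrite ltr_wpDl// divr_gt0.
pose c := Num.sqrt t^-1.
have c2 : c ^+ 2 = t^-1 by rewrite sqr_sqrtr// invr_ge0 ltW.
have cx0 i : 0 <= c * x i by rewrite mulr_ge0// sqrtr_ge0.
have [y2 yn] := l2norm_sqr (esum_gram s dB dB cx0).
have [_ zn] := l2norm_sqr (esum_gram s dDB dDB cx0).
have y1 : l2norm (fapp B s (fun i => c * x i)) <= 1.
  rewrite -(@ler_pXn2r _ 2)// ?nnegrE ?sqrtr_ge0// expr1n yn qform_scale c2.
  by rewrite mulrC ler_pdivrMr// mul1r -/m lerDl divr_ge0 ?(ltW e0) ?(ltW L0).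
have : l2norm (fapp (mulm D B) s (fun i => c * x i)) <= opnorm D.
  apply: ub_le_sup; first by case: (opnorm_has_sup dD).
  by exists (fapp B s (fun i => c * x i)) => //; rewrite opapp_fapp.
rewrite -ler_sqr ?nnegrE ?sqrtr_ge0 ?opnorm_ge0// zn qform_scale c2.
rewrite mulrC ler_pdivrMr// => /le_trans; apply.
(* The denominator in [t] keeps the slack, multiplied by [opnorm D ^+ 2], below [e]. *)
by rewrite mulrDr lerD2l mulrCA ler_piMr ?(ltW e0)// ler_pdivrMr// mul1r lerDl.
Qed.

End Gram.

(** * Theta and the moments of a finitely supported vector *)

Section Theta.
Variables (R : realType) (I : choiceType) (B : I -> I -> R).
Hypothesis dB : doubly_stochastic B.
Implicit Types (F : {fset I}) (x : I -> R).

Lemma Theta_ubound F :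
  \sum_(i <- F) \sum_(j <- F) B i j <= Theta B * (#|` F|)%:R.
Proof.
have [->|F0] := eqVneq F fset0.
  by rewrite big_seq_fset0 cardfs0 mulr0.
rewrite -ler_pdivrMr ?ltr0n ?cardfs_gt0// mulrC.
apply: ub_le_sup; last by exists F.
exists 1 => _ [S S0 <-].
rewrite mulrC ler_pdivrMr ?ltr0n ?cardfs_gt0// mul1r -sum1_size natr_sum.
by apply: ler_sum => i _; exact: ds_row_le1.
Qed.

Lemma Theta_le (c : R) : inhabited I ->
    (forall F, \sum_(i <- F) \sum_(j <- F) B i j <= c * (#|` F|)%:R) ->
  Theta B <= c.
Proof.
case=> i0 hc; apply: ge_sup => [|_ [S S0 <-]].
  exists ((#|` [fset i0]%fset|%:R)^-1 *
    \sum_(i <- [fset i0]%fset) \sum_(j <- [fset i0]%fset) B i j).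
  exists [fset i0]%fset => //=.
  by apply/fset0Pn; exists i0; rewrite inE.
by rewrite mulrC ler_pdivrMr ?ltr0n ?cardfs_gt0.
Qed.

Lemma Theta_le1 : inhabited I -> Theta B <= 1.
Proof.
move=> I0; apply: Theta_le => // F.
rewrite mul1r -sum1_size natr_sum.
by apply: ler_sum => i _; exact: ds_row_le1.
Qed.

Lemma Theta_ge0 : inhabited I -> 0 <= Theta B.
Proof.
case=> i0; have := Theta_ubound [fset i0]%fset.
rewrite cardfs1 mulr1; apply: le_trans.
by do 2![apply: sumr_ge0 => ? _]; exact: ds_ge0.
Qed.

(** A subsequence of [F] is duplicate-free, so it enumerates a finite set; [cheeger] asks for the
    bound in this form. *)
Lemma Theta_subseq F (t : seq I) : subseq t F ->
  \sum_(i <- t) \sum_(j <- t) B i j <= Theta B * (size t)%:R.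
Proof.
move=> /subseq_uniq/(_ (fset_uniq F)) tu.
have pt : perm_eq t [fset i in t]%fset.
  by apply: uniq_perm => // i; rewrite inE.
have := Theta_ubound [fset i in t]%fset.
rewrite -(perm_size pt) (perm_big _ pt)/=; apply: le_trans.
by apply: ler_sum => i _; rewrite (perm_big _ pt).
Qed.

Lemma qform_cheeger F x : adjm B = B -> inhabited I -> (forall i, 0 <= x i) ->
  qform F x B ^+ 2 <= (2 * Theta B - Theta B ^+ 2) * sqnorm F x ^+ 2.
Proof.
move=> Bs I0 x0; apply: cheeger => //.
- exact: ds_ge0.
- by move=> i j; rewrite -{1}Bs.
- by move=> i; exact: ds_row_le1.
- by move=> t; exact: Theta_subseq.
- exact: Theta_le1.
Qed.

Lemma qform_le_Theta F x : (forall i, 0 <= x i) ->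
  qform F x B <= Theta B * (#|` F|)%:R * sqnorm F x.
Proof.
move=> x0; apply: (@le_trans _ _
    ((\sum_(i <- F) \sum_(j <- F) B i j) * sqnorm F x)); last first.
  by rewrite ler_wpM2r ?sqnorm_ge0 ?Theta_ubound.
rewrite mulr_suml /qform big_seq [leRHS]big_seq; apply: ler_sum => i iF.
rewrite mulr_suml; rewrite big_seq [leRHS]big_seq; apply: ler_sum => j jF.
rewrite ler_wpM2l ?ds_ge0//.
have xN k : k \in F -> x k ^+ 2 <= sqnorm F x.
  move=> kF; rewrite /sqnorm (bigD1_seq k)//= lerDl.
  by apply: sumr_ge0 => l _; exact: sqr_ge0.
(* The product [x i * x j] is at most the mean of the two squares. *)
have := xN i iF; have := xN j jF; have := sqr_ge0 (x i - x j).
by rewrite !expr2; lra.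
Qed.

Lemma qform_one F : qform F (fun=> 1) B = \sum_(i <- F) \sum_(j <- F) B i j.
Proof. by do 2![apply: eq_bigr => ? _]; rewrite !mulr1. Qed.

End Theta.

Section Powers.
Variables (R : realType) (I : choiceType) (D : I -> I -> R).
Hypothesis dD : doubly_stochastic D.
Local Notation A := (mulm (adjm D) D).
Implicit Types (F : {fset I}) (x : I -> R).

Let dA : doubly_stochastic A. Proof. exact: gram_ds. Qed.

Lemma sqnorm_one F : sqnorm F (fun=> 1 : R) = (#|` F|)%:R.
Proof.
by rewrite /sqnorm -sum1_size natr_sum; apply: eq_bigr => i _; rewrite expr1n.
Qed.

Lemma qform_expm0 F x : qform F x (expm A 0) = sqnorm F x.
Proof.
apply: eq_big_seq => i iF; rewrite (bigD1_seq i)//= eqxx mul1r expr2.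
rewrite big1 ?addr0//.
by move=> j ji; rewrite eq_sym (negPf ji) mul0r.
Qed.

(** Take [H = A^k] for [n = 2k] and [H = D A^k] for [n = 2k + 1], using that [A] is self-adjoint.
    Every moment is thus a squared norm. *)
Lemma expm_gram_half n : exists2 H, doubly_stochastic H &
  mulm (adjm H) H = expm A n.
Proof.
have dE k := expm_ds k dA; have As := adjm_gram D.
rewrite -[n]odd_double_half; move: n./2 => k; case: (odd n).
  exists (mulm D (expm A k)); first exact: mulm_ds.
  rewrite gram_mulm// adjm_expm// add1n -addnn -addnS expmD//.
  by rewrite -mulmA.
exists (expm A k); first exact: dE.
by rewrite adjm_expm// add0n -addnn expmD.
Qed.

Section Moments.
Variables (F : {fset I}) (x : I -> R).
Hypothesis x0 : forall i, 0 <= x i.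
Local Notation m n := (qform F x (expm A n)).

Lemma moment_ge0 n : 0 <= m n.
Proof. by apply: qform_ge0 => //; exact: expm_ds. Qed.

(** Cauchy-Schwarz for [H x] and [H A x], where [A^n = H^* H]. *)
Lemma moment_logconvex n : m n.+1 ^+ 2 <= m n * m n.+2.
Proof.
have [H dH HE] := expm_gram_half n.
have HA : mulm (adjm H) (mulm H A) = expm A n.+1.
  by rewrite mulmA ?HE ?expmSr//; exact: adjm_ds.
have HAA : mulm (adjm (mulm H A)) (mulm H A) = expm A n.+2.
  by rewrite gram_mulm// HE adjm_gram; exact/esym/(expmSr n.+1 dA).
by rewrite -HA -HAA -HE; apply: qform_gram_cauchy_schwarz => //; exact: mulm_ds.
Qed.

Lemma moment_double n : m n.*2.+1 <= opnorm D ^+ 2 * m n.*2.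
Proof.
have dE := expm_ds n dA; have Es := adjm_expm n dA (adjm_gram D).
have := @qform_le_opnorm _ _ D (expm A n) F x dD dE x0.
rewrite gram_mulm// Es -expmD// addnn -mulmA//.
rewrite -[mulm A (expm A n)]/(expm A n.+1).
by rewrite -expmD// addnS addnn.
Qed.

Lemma moment_le n : m n <= (opnorm D ^+ 2) ^+ n * sqnorm F x.
Proof.
rewrite -qform_expm0.
apply: (@logconvex_ratio _ (fun n => m n)) => //; last exact: moment_double.
- exact: moment_ge0.
- exact: moment_logconvex.
- exact: sqr_ge0.
Qed.

Lemma moment_exp n : qform F x A ^+ n.+1 <= m n.+1 * sqnorm F x ^+ n.
Proof.
have := logconvex_exp moment_ge0 moment_logconvex n.
by rewrite expm1// qform_expm0.
Qed.

End Moments.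
End Powers.

(** * The bounds *)

Section Root.
Variable R : realType.
Implicit Types a c : R.

Lemma exprn_powR_inv c n : (0 < n)%N -> 0 <= c -> (c `^ n%:R^-1) ^+ n = c.
Proof.
move=> n0 c0; rewrite -powR_mulrn ?powR_ge0// -powRrM mulVf ?powRr1//.
by rewrite pnatr_eq0 -lt0n.
Qed.

Lemma powR_inv_le a c n : (0 < n)%N -> 0 <= a -> 0 <= c -> c <= a ^+ n ->
  c `^ n%:R^-1 <= a.
Proof.
move=> n0 a0 c0 h.
by rewrite -(@ler_pXn2r _ n) ?nnegrE ?powR_ge0// exprn_powR_inv.
Qed.

End Root.

Section Norm.
Variables (R : realType) (I : choiceType) (D : I -> I -> R).
Hypotheses (I0 : inhabited I) (dD : doubly_stochastic D).
Local Notation A := (mulm (adjm D) D).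
Local Notation theta n := (Theta (expm A n)).

Let dE n : doubly_stochastic (expm A n).
Proof. by apply: expm_ds; exact: gram_ds. Qed.

Lemma Theta_expm_le n : theta n <= (opnorm D ^+ 2) ^+ n.
Proof.
apply: Theta_le => // F; rewrite -qform_one -(sqnorm_one R F).
exact: moment_le.
Qed.

Lemma root_Theta_le n : (1 <= n)%N -> theta n `^ n%:R^-1 <= opnorm D ^+ 2.
Proof.
by move=> n1; apply: powR_inv_le; rewrite ?sqr_ge0 ?Theta_ge0 ?Theta_expm_le.
Qed.

Lemma opnorm_sqr_le_cheeger n : (1 <= n)%N ->
  opnorm D ^+ 2 <= (2 * theta n - theta n ^+ 2) `^ (2 * n)%:R^-1.
Proof.
move=> n1; set c := 2 * _ - _.
have c0 : 0 <= c.
  have := Theta_ge0 (dE n) I0; have := Theta_le1 (dE n) I0.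
  by rewrite /c expr2; nra.
apply: opnorm_sqr_le => //; first exact: powR_ge0.
move=> F x x0; have N0 := sqnorm_ge0 F x.
have M0 : 0 <= qform F x A by apply: qform_ge0 => //; exact: gram_ds.
have n2 : (0 < 2 * n)%N by rewrite muln_gt0.
(* Raising to the power [2n] removes the root; the goal becomes [m_1^(2n) <= c N^(2n)], reached
   through [(m_n N^(n-1))^2]. *)
rewrite -(@ler_pXn2r _ (2 * n)) ?nnegrE ?mulr_ge0 ?powR_ge0//.
rewrite exprMn exprn_powR_inv// mulnC !exprM.
have := moment_exp dD F x0 n.-1; rewrite prednK// => hm.
apply: (@le_trans _ _ ((qform F x (expm A n) * sqnorm F x ^+ n.-1) ^+ 2)).
  by rewrite ler_sqr ?nnegrE ?exprn_ge0 ?mulr_ge0 ?moment_ge0 ?exprn_ge0.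
rewrite -[in leRHS](prednK n1) (exprS _ n.-1).
rewrite !exprMn mulrA ler_wpM2r ?sqr_ge0//.
apply: qform_cheeger => //.
by apply: adjm_expm; [exact: gram_ds|exact: adjm_gram].
Qed.

Lemma opnorm_sqr_sup : opnorm D ^+ 2 =
  sup [set theta n `^ n%:R^-1 | n in [set n : nat | (1 <= n)%N]].
Proof.
set S := [set _ | _ in _].
have ubS : ubound S (opnorm D ^+ 2) by move=> _ [n n1 <-]; exact: root_Theta_le.
have S0 : S !=set0 by exists (theta 1 `^ 1%:R^-1); exists 1%N.
have sup0 : 0 <= sup S.
  apply: (le_trans (powR_ge0 (theta 1) 1%:R^-1)).
  by apply: ub_le_sup; [exists (opnorm D ^+ 2)|exists 1%N].
apply/eqP; rewrite eq_le ge_sup// andbT.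
apply: opnorm_sqr_le => // F x x0; have N0 := sqnorm_ge0 F x.
(* The constant [|F|] comes from [qform_le_Theta] and does not depend on the exponent;
   [Theta (expm A n.+1)] is at most [sup S ^+ n.+1]. *)
apply: (@exp_dominated _ _ _ (#|` F|)%:R); rewrite ?mulr_ge0//.
  by apply: qform_ge0 => //; exact: gram_ds.
move=> n; apply: (le_trans (moment_exp dD F x0 n)).
apply: (@le_trans _ _ (theta n.+1 * (#|` F|)%:R * sqnorm F x ^+ n.+1)).
  by rewrite exprS mulrA ler_wpM2r ?exprn_ge0 ?qform_le_Theta.
rewrite exprMn mulrA ler_wpM2r ?exprn_ge0// mulrC ler_wpM2l//.
rewrite -[leLHS](@exprn_powR_inv _ _ n.+1) ?Theta_ge0//.
rewrite ler_pXn2r ?nnegrE ?powR_ge0//.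
by apply: ub_le_sup; [exists (opnorm D ^+ 2)|exists n.+1].
Qed.

End Norm.

Unset Implicit Arguments.

Theorem proposition7 (R : realType) (I : choiceType) (I_nonempty : inhabited I)
    (D : I -> I -> R) (hD : doubly_stochastic D) :
  let A := mulm (adjm D) D in
  opnorm D ^+ 2
    = sup [set Theta (expm A n) `^ n%:R^-1 | n in [set n : nat | (1 <= n)%N]]
  /\ (forall n : nat, (1 <= n)%N ->
        Theta (expm A n) `^ n%:R^-1 <= opnorm D ^+ 2 /\
        opnorm D ^+ 2
          <= (2 * Theta (expm A n) - Theta (expm A n) ^+ 2) `^ (2 * n)%:R^-1).
Proof.
move=> A; split; first exact: opnorm_sqr_sup.
by move=> n n1; split; [exact: root_Theta_le|exact: opnorm_sqr_le_cheeger].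
Qed.
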